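(* If the semicascade $(\Omega,\varphi)$ is tame, then $M^c(\Omega)=Z(\Omega)$, i.e. the closure of the union of all minimal sets of $(\Omega,\varphi)$ coincides with the minimal attraction center of $(\Omega,\varphi)$.
   Context: $\Omega$ is a metrizable compact space and $\varphi:\Omega\to\Omega$ is a continuous (not necessarily invertible) map; $(\Omega,\varphi)$ is the corresponding semicascade. A minimal set is a nonempty closed set $m\subset\Omega$ with $\varphi m\subset m$ that has no proper subset with the same properties. $M(\Omega)$ is the union of all minimal sets and $M^c(\Omega)$ is its closure in $\Omega$. A $\varphi$-ergodic measure is a $\varphi$-invariant Borel probability measure $\lambda$ on $\Omega$ such that $\lambda(e)\in\{0,1\}$ for every Borel set $e$ with $\varphi^{-1}e=e$. The minimal attraction center $Z(\Omega)$ is the closure of the union of the supports of all $\varphi$-ergodic measures. The semicascade is tame if, for each $x\in C(\Omega)$ (continuous scalar function) and each increasing sequence $\{n(k)\}$ of positive integers, $\inf_a\|\sum_{k\ge 1}a_kx_{n(k)}\|_{C(\Omega)}=0$, where $x_n(\omega)=x(\varphi^n\omega)$ and the infimum is over finite (finitely supported) real sequences $a=\{a_k\}$ with $\sum_k|a_k|=1$. *)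

(* Defs.v *)
From HB Require Import structures.
From mathcomp Require Import all_boot all_order all_algebra.
From mathcomp Require Import all_classical all_reals all_analysis.

Set Implicit Arguments.
Unset Strict Implicit.
Unset Printing Implicit Defensive.

Import Order.TTheory GRing.Theory Num.Theory.
Import numFieldTopology.Exports numFieldNormedType.Exports.

Local Open Scope classical_set_scope.
Local Open Scope ring_scope.

Definition metrizable (R : realType) (T : topologicalType) : Prop :=
  exists (M : metricType R) (f : T -> M) (g : M -> T),
    [/\ cancel f g, cancel g f, continuous f & continuous g].

Definition closed_forward_invariant (T : topologicalType) (phi : T -> T)
    (m : set T) : Prop :=
  [/\ m !=set0, closed m & phi @` m `<=` m].

Definition minimal_set (T : topologicalType) (phi : T -> T) (m : set T) : Prop :=
  closed_forward_invariant phi m /\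
  forall m', closed_forward_invariant phi m' -> ~ m' `<` m.

Definition minimal_union (T : topologicalType) (phi : T -> T) : set T :=
  \bigcup_(m in [set m | minimal_set phi m]) m.

Definition borel (T : ptopologicalType) := g_sigma_algebraType (@open T).

Definition invariant_measure (R : realType) (T : ptopologicalType)
    (phi : T -> T) (mu : probability (borel T) R) : Prop :=
  forall e : set (borel T), measurable e -> mu (phi @^-1` e) = mu e.

Definition ergodic_measure (R : realType) (T : ptopologicalType)
    (phi : T -> T) (mu : probability (borel T) R) : Prop :=
  invariant_measure phi mu /\
  forall e : set (borel T), measurable e -> phi @^-1` e = e ->
    mu e = 0%E \/ mu e = 1%E.

Definition measure_support (R : realType) (T : ptopologicalType)
    (mu : probability (borel T) R) : set T :=
  [set w | forall U : set T, open U -> U w -> (0 < mu U)%E].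

Definition attraction_center (R : realType) (T : ptopologicalType)
    (phi : T -> T) : set T :=
  closure (\bigcup_(mu in [set mu : probability (borel T) R |
                           ergodic_measure phi mu]) measure_support mu).

(* [sup] is the genuine supremum here only for bounded f; below it is applied
   to continuous functions on a nonempty compact space. *)
Definition sup_norm (R : realType) (T : Type) (f : T -> R) : R :=
  sup (range (fun w => `|f w|)).

(* Sequences are indexed from 0; a finitely supported sequence is given by its
   first N terms.  The set whose infimum is taken is nonempty (N = 1, a 0 = 1)
   and bounded below by 0, so [inf] is its genuine infimum. *)
Definition tame (R : realType) (T : topologicalType) (phi : T -> T) : Prop :=
  forall x : T -> R, continuous x ->
  forall n : nat -> nat, increasing_seq n -> (forall k, (0 < n k)%N) ->
  inf [set c | exists (N : nat) (a : nat -> R),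
         \sum_(k < N) `|a k| = 1 /\
         c = sup_norm (fun w => \sum_(k < N) a k * x (iter (n k) phi w))] = 0.

(* Main.v *)
(* Both inclusions avoid integration and the representation theorem.

   Supports of invariant measures lie in the closure of the minimal sets.  In
   the compact space of all maps with the product topology, the closure of the
   tail of the sequence of iterates contains a minimal set; a point p of it maps
   every x into a minimal set, and a free ultrafilter U on nat carries the
   iterates to p.  If A is open and f >= c > 0 on A while f = 0 near the minimal
   sets, then along U each single orbit leaves A.  Tameness upgrades this: every
   nonempty E has a nonempty relatively open piece whose iterates avoid A for
   U-many n, since otherwise one builds an independent (hence l1) subsequence of
   the iterates of f.  Exhausting the space by such pieces shows that
   mu (phi^-n A) is small for U-many n, so mu A = 0 by invariance.

   Conversely a minimal set m is the support of any invariant measure living on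
   it.  An ergodic one is obtained by successively maximising mu m, mu K_1,
   mu K_2, ... over invariant measures, where the K_i run through the
   complements of finite unions of basic open sets.  The maxima are attained
   because an ultralimit of measures is a finitely additive content, from which
   an outer measure produces a Borel measure that is at least as large on closed
   sets. *)
Require Import Defs.
From HB Require Import structures.
From mathcomp Require Import all_boot all_order all_algebra.
From mathcomp Require Import all_classical all_reals all_analysis.
From mathcomp Require Import lra.

Set Implicit Arguments.
Unset Strict Implicit.
Unset Printing Implicit Defensive.

Import Order.TTheory GRing.Theory Num.Theory.
Import numFieldTopology.Exports numFieldNormedType.Exports.

Local Open Scope classical_set_scope.
Local Open Scope ring_scope.

(** * Minimal sets and limits of iterates *)

(** Zorn is applied to the parts removed from [K]: the remainders of a chain are nested nonempty
    closed sets, so they have a common point by compactness, and a maximal removed part leaves a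
    minimal set. *)
Lemma exists_minimal_set (X : topologicalType) (f : X -> X) (K : set X) :
  compact [set: X] -> closed_forward_invariant f K ->
  exists2 m, minimal_set f m & m `<=` K.
Proof.
move=> cptX [K0 cK fK].
pose P := [set A : set X | closed_forward_invariant f (K `\` A)].
have [|A [PA maxA]] := @Zorn_bigcup X P.
  move=> F FP totF; rewrite /P /=.
  have [[A0 FA0]|F0] := pselect (F !=set0); last first.
    suff -> : \bigcup_(A in F) A = set0 by rewrite setD0.
    by apply/seteqP; split=> // x [A FA _]; apply: F0; exists A.
  have KDE : K `\` \bigcup_(A in F) A = \bigcap_(A in F) (K `\` A).
    apply/seteqP; split=> [x [Kx nx] A FA|x h].
      by split=> // Ax; apply: nx; exists A.
    by split=> [|[A FA Ax]]; [have [] := h _ FA0|have [_] := h _ FA].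
  have FF : ProperFilter (filter_from F (fun A => K `\` A)).
    apply: filter_from_proper; last by move=> A /FP [].
    apply: filter_from_filter; first by exists A0.
    move=> A B FA FB; have [AB|BA] := totF _ _ FA FB.
      by exists B => // x [Kx nBx]; do 2!split=> //; move/AB.
    by exists A => // x [Kx nAx]; do 2!split=> //; move/BA.
  rewrite KDE; split.
  - have [p [_ clp]] := cptX _ FF filterT.
    exists p => A FA; have [_ + _] := FP _ FA; apply=> U Up.
    by apply: (clp _ _ _ Up); exists A.
  - by apply: closed_bigI => A /FP [].
  - move=> _ [x h <-] A FA; have [_ _] := FP _ FA; apply.
    by exists x => //; exact: h.
exists (K `\` A); last by move=> x [].
split=> // m' m'inv [m'KA]; apply.
apply: contrapT => nKAm'; apply: (maxA (~` m')).
  split=> [x Ax m'x|AC]; first by have [] := m'KA x m'x.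
  by apply: nKAm' => x [Kx nAx]; apply: contrapT => /AC.
rewrite /P /= setDE setCK; suff -> : K `&` m' = m' by [].
by apply: setIidr => x /m'KA [].
Qed.

(** A closed invariant set strictly inside the image would pull back to a closed invariant proper
    subset of [m]. *)
Lemma minimal_set_image (X Y : topologicalType) (f : X -> X) (g : Y -> Y)
    (h : X -> Y) (m : set X) :
  compact [set: X] -> hausdorff_space Y -> continuous h ->
  (forall x, h (f x) = g (h x)) -> minimal_set f m -> minimal_set g (h @` m).
Proof.
move=> cptX hY ch hf [[[x mx] cm fm] minm]; split.
  split; first by exists (h x), x.
    apply: compact_closed => //; apply: continuous_compact.
      exact: continuous_subspaceT.
    exact: subclosed_compact cptX _.
  by move=> _ [_ [a ma <-] <-]; exists (f a) => //; apply: fm; exists a.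
move=> m' [[y m'y] cm' gm'] [m'hm]; apply=> _ [a ma <-].
have [b mb hb] := m'hm _ m'y.
suff : m `<=` m `&` h @^-1` m' by move=> /(_ _ ma) [].
apply: contrapT => nsub; apply: (minm (m `&` h @^-1` m')).
  split; first by exists b; split=> //=; rewrite hb.
    by apply: closedI => //; apply: preimage_closed => // z _; exact: ch.
  move=> _ [z [mz m'z] <-]; split; first by apply: fm; exists z.
  by rewrite /= hf; apply: gm'; exists (h z).
by split=> // z [].
Qed.

Lemma continuous_ptws (X Y : topologicalType) (I : Type)
    (f : X -> {ptws I -> Y}) :
  (forall i, continuous (fun x => f x i)) -> continuous f.
Proof.
move=> cf x; apply/cvg_sup => i U [V [[W oW <-] /= Wf /filterS]]; apply.
by apply: cf; exact: open_nbhs_nbhs.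
Qed.

(* [p] is an element of a minimal left ideal of the enveloping semigroup; the
   free ultrafilter [U] is one along which the iterates of [phi] converge
   pointwise to [p]. *)
Lemma ultrafilter_to_minimal_union (T : ptopologicalType) (phi : T -> T) :
  hausdorff_space T -> compact [set: T] -> continuous phi ->
  exists U : set_system nat, [/\ UltraFilter U,
    forall N, U [set n | (N <= n)%N] &
    forall (B : set T) x, open B -> minimal_union phi `<=` B ->
      U [set n | B (iter n phi x)] ].
Proof.
move=> hT cptT cphi.
pose X : topologicalType := {ptws T -> T}.
have cptX : compact [set: X].
  have := @tychonoff T (fun=> T) (fun=> [set: T]) (fun=> cptT).
  by congr compact; apply/seteqP.
pose Phi : X -> X := fun g => phi \o g.
have cPhi : continuous Phi.
  apply: continuous_ptws => t g /=.
  apply: (@continuous_comp X T T (fun g : X => g t) phi).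
    exact: (@proj_continuous T (fun=> T) t).
  exact: cphi.
pose orb N : set X := [set iter n phi | n in [set n | (N <= n)%N]].
(* This is the omega-limit set of the identity map under [Phi]. *)
pose K := \bigcap_N closure (orb N).
have PhiK : closed_forward_invariant Phi K.
  split.
  - have FF : ProperFilter (filter_from [set: nat] orb).
      apply: filter_from_proper; last by move=> N _; exists (iter N phi), N => /=.
      apply: filter_from_filter; first by exists 0%N.
      move=> i j _ _; exists (maxn i j) => // _ [n /= ijn <-].
      by move: ijn; rewrite geq_max => /andP[? ?]; split; exists n.
    have [p [_ clp]] := cptX _ FF filterT.
    by exists p => N _ V Vp; apply: (clp _ _ _ Vp); exists N.
  - by apply: closed_bigI => N _; exact: closed_closure.
  - move=> _ [g Kg <-] N _ V /cPhi Vg.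
    have [_ [[n /= Nn <-] Vn]] := Kg N I _ Vg.
    by exists (iter n.+1 phi); split=> //; exists n.+1 => //=; exact: leqW.
have [m [[[p mp] cm Phim] minm] mK] := exists_minimal_set cptX PhiK.
(* Evaluation at [x] intertwines [Phi] with [phi], so it sends [m] onto a minimal set, and this set
   contains [p x]. *)
have px x : minimal_union phi (p x).
  exists ((fun g : X => g x) @` m); last by exists p.
  apply: (@minimal_set_image X T Phi) => //; last by split=> //; split=> //; exists p.
  exact: (@proj_continuous T (fun=> T) x).
(* The sets of late times at which the iterates lie near [p] generate a filter, proper because [p]
   is in the closure of every tail. *)
pose base := [set VN : set X * nat | nbhs p VN.1].
pose G VN := [set n | (VN.2 <= n)%N /\ (VN.1 : set X) (iter n phi)].
have FG : ProperFilter (filter_from base G).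
  apply: filter_from_proper.
    apply: filter_from_filter; first by exists (setT, 0%N); exact: filterT.
    move=> [V i] [W j] /= Vp Wp; exists (V `&` W, maxn i j).
      exact: (@filterI _ (nbhs p)).
    by move=> n [/=]; rewrite geq_max => /andP[? ?] [].
  move=> [V N] /= Vp; have [_ [[n /= Nn <-] Vn]] := mK _ mp N I _ Vp.
  by exists n.
have [U [UU FU]] := ultraFilterLemma FG.
exists U; split=> // [N|B x oB MB].
  by apply: FU; exists (setT, N); [exact: filterT|move=> n []].
apply: FU; exists ([set g : X | B (g x)], 0%N); last by move=> n [].
have cx : continuous (fun g : X => g x) by exact: (@proj_continuous T (fun=> T) x).
apply: (cx p B); apply: open_nbhs_nbhs; split=> //; exact/MB/px.
Qed.

(** * Tameness excludes independence *)

Section tame_independence.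
Context (R : realType) (T : ptopologicalType) (phi : T -> T).
Context (f : T -> R) (c : R) (A B : set T).
Hypotheses (phi_tame : tame R phi) (cf : continuous f) (c_gt0 : 0 < c).
Hypotheses (f01 : forall w, 0 <= f w <= 1) (fA : forall w, A w -> c <= f w)
  (fB : forall w, B w -> f w = 0).

Let side (b : bool) := if b then A else B.

(* Testing a combination of the iterates at the two points following the sign
   pattern of its coefficients and the opposite pattern gives the lower
   l1-estimate [c / 2]. *)
Lemma tame_not_independent (n : nat -> nat) :
  increasing_seq n -> (forall k, (0 < n k)%N) ->
  ~ forall N (s : nat -> bool), exists x,
      forall k, (k < N)%N -> side (s k) (iter (n k) phi x).
Proof.
move=> n_incr n_gt0 ind; have := phi_tame cf n_incr n_gt0.
set S := (X in inf X); move=> infS.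
suff : c / 2 <= inf S by rewrite infS => ?; have := c_gt0; lra.
apply: lb_le_inf.
  pose a (k : nat) : R := (k == 0%N)%:R.
  exists (sup_norm (fun w => \sum_(k < 1) a k * f (iter (n k) phi w))).
  by exists 1%N, a; rewrite big_ord1 /a eqxx normr1.
move=> _ [N [a [a1 ->]]].
pose F w := \sum_(k < N) a k * f (iter (n k) phi w).
have F_le w : `|F w| <= sup_norm F.
  apply: ub_le_sup; last by exists w.
  exists 1 => _ [v _ <-]; rewrite -a1; apply: le_trans (ler_norm_sum _ _ _) _.
  apply: ler_sum => k _; rewrite normrM ler_piMr //.
  by have /andP[? ?] := f01 (iter (n k) phi v); rewrite ger0_norm.
have [x xs] := ind N (fun k => 0 <= a k).
have [y ys] := ind N (fun k => ~~ (0 <= a k)).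
suff : c <= F x - F y.
  have := F_le x; have := F_le y; rewrite !ler_norml -/F => /andP[? ?] /andP[? ?].
  lra.
rewrite -(mulr1 c) -a1 mulr_sumr /F -sumrB; apply: ler_sum => k _.
have := xs k (ltn_ord k); have := ys k (ltn_ord k).
have [ak|ak] := leP 0 (a k) => /= [/fB -> /fA cx|/fA cy /fB ->].
  by rewrite mulr0 subr0 mulrC ger0_norm // ler_wpM2l.
by rewrite mulr0 sub0r mulrC ltr0_norm // mulNr lerN2 ler_wnM2l // ltW.
Qed.

Context (U : set_system nat).
Hypotheses (UU : UltraFilter U) (Ufree : forall N, U [set n | (N <= n)%N]).
Hypotheses (UB : forall x, U [set n | B (iter n phi x)]).
Hypotheses (phi_cont : continuous phi) (oA : open A) (oB : open B).

Lemma continuous_iter n : continuous (iter n phi).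
Proof.
elim: n => [|n IHn] x; first exact: cvg_id.
by apply: (@continuous_comp _ _ _ (iter n phi) phi); [exact: IHn|exact: phi_cont].
Qed.

(* Otherwise, the cells of [E] cut out by finitely many preimages of [A] and
   [B] can be split again and again, which gives an independent sequence. *)
Lemma tame_fragmented (E : set T) : E !=set0 ->
  exists2 O, open O /\ O `&` E !=set0 &
    U [set n | forall x, O x -> E x -> ~ A (iter n phi x)].
Proof.
move=> E0; apply: contrapT => noO.
have meetA O : open O -> O `&` E !=set0 ->
    U [set n | exists x, [/\ O x, E x & A (iter n phi x)]].
  move=> oO OE; set V := [set n | _].
  have [//|UV] := in_ultra_setVsetC V UU.
  case: noO; exists O => //; apply: filterS UV => n nV x Ox Ex Ax.
  by apply: nV; exists x.
pose cell (l : seq nat) (s : nat -> bool) := [set x | forall k, (k < size l)%N ->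
  side (s k) (iter (nth 0%N l k) phi x)].
have ocell l s : open (cell l s).
  rewrite openE => x xc; rewrite /interior.
  have : nbhs x [set z | forall k : 'I_(size l),
      side (s k) (iter (nth 0%N l k) phi z)].
    apply: filter_forall => k.
    apply: (@continuous_iter (nth 0%N l k) x (side (s k))).
    apply: open_nbhs_nbhs; split; first by rewrite /side; case: ifP.
    exact: xc.
  by apply: filterS => z zc k kl; exact: (zc (Ordinal kl)).
pose ind l := forall s, exists2 x, E x & cell l s x.
(* The bound by [last] makes the chosen times increase; its default 0 on the empty list makes the
   first time positive, as in the definition of tameness. *)
have /choice[F indF] : forall l, exists j,
    ind l -> (last 0%N l < j)%N /\ ind (rcons l j).
  move=> l; have [indl|] := pselect (ind l); last by exists 0%N.
  (* There are finitely many sign patterns, so one [U]-large set of times splits all cells at once: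
     [UB] keeps a given point of the cell in [B], and [meetA] supplies a point for [A]. *)
  have UAB : U [set n | forall t : (size l).-tuple bool, forall b,
      exists2 x, E x & cell l (nth false t) x /\ side b (iter n phi x)].
    apply: filter_forall => t; have [x Ex xc] := indl (nth false t).
    have := meetA _ (ocell l (nth false t)) (ex_intro _ x (conj xc Ex)).
    move=> /(@filterI _ U _ _ _ (UB x)); apply: filterS => n [Bx [y [yc Ey Ay]]].
    by case; [exists y|exists x].
  have [j [lj jAB]] := filter_ex (filterI (Ufree (last 0%N l).+1) UAB).
  exists j => _; split=> // s.
  have [x Ex [xc xj]] := jAB [tuple of mkseq s (size l)] (s (size l)).
  exists x => // k; rewrite size_rcons ltnS nth_rcons leq_eqVlt.
  case/predU1P => [->|kl]; first by rewrite ltnn eqxx.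
  by rewrite kl; have := xc k kl; rewrite nth_mkseq.
pose L := fix L k := if k is k'.+1 then rcons (L k') (F (L k')) else [::].
have sizeL k : size (L k) = k by elim: k => //= k IHk; rewrite size_rcons IHk.
have indL k : ind (L k).
  by elim: k => [s|k /indF[]//]; have [x Ex] := E0; exists x.
pose n k := F (L k).
have nthL N k : (k < N)%N -> nth 0%N (L N) k = n k.
  elim: N => // N IHN; rewrite ltnS leq_eqVlt nth_rcons sizeL.
  by case/predU1P => [->|kN]; [rewrite ltnn eqxx|rewrite kN IHN].
have lastL k : (last 0%N (L k) < n k)%N by have [] := indF _ (indL k).
apply: (@tame_not_independent n).
- apply/increasing_seqP => k; have := lastL k.+1.
  by rewrite [L k.+1]/= last_rcons.
- by move=> k; exact: leq_ltn_trans (lastL k).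
- move=> N s; have [x _ xc] := indL N s; exists x => k kN.
  by have := xc k; rewrite sizeL nthL // => /(_ kN).
Qed.

End tame_independence.

(** * Consequences of metrizability *)

Lemma metrizable_hausdorff (R : realType) (T : topologicalType) :
  metrizable R T -> hausdorff_space T.
Proof.
move=> [M [f [g [fK _ cf _]]]] p q pq; apply: (can_inj fK).
apply: (@metric_hausdorff R M) => V W /cf Vp /cf Wq.
by have [z [Vz Wz]] := pq _ _ Vp Wq; exists (f z).
Qed.

Lemma metrizable_countable_base (R : realType) (T : ptopologicalType) :
  metrizable R T -> compact [set: T] ->
  exists2 base : nat -> set T, (forall i, open (base i)) &
    forall x O, open O -> O x -> exists2 i, base i x & base i `<=` O.
Proof.
move=> [M [f [g [fK gK cf cg]]]] cptT.
pose P : pseudoPMetricType R :=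
  HB.pack (Metric.sort M) (isPointed.Build (Metric.sort M) (f point)).
have cptP : compact [set: P].
  have -> : [set: P] = f @` [set: T].
    by apply/seteqP; split=> // x _; exists (g x).
  by apply: continuous_compact => //; exact: continuous_subspaceT.
have [B cB [oB Bbase]] := compact_second_countable cptP.
have [i0 Bi0 _] : exists2 i, B i & True.
  by have [b [Bb _] _] := Bbase (f point) setT filterT; exists b.
have /pfcard_geP[B0|[h]] := cB; first by move: Bi0; rewrite B0.
exists (fun i => f @^-1` (h i)) => [i|x O oO Ox].
  by apply: open_comp => [z _|]; [exact: cf|exact/oB/funS].
have : nbhs (f x : P) (g @^-1` O).
  by apply: cg; rewrite fK; exact: open_nbhs_nbhs.
move=> /Bbase[b [Bb bfx] bO]; have [i _ hi] := @surj _ _ _ _ h _ Bb.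
exists i => /=; first by rewrite hi.
by move=> z /=; rewrite hi => /bO /=; rewrite fK.
Qed.

(** * Finite approximation of countable unions *)

Section finite_measure_lemmas.
Context d (T : measurableType d) (R : realType).
Context (mu : {finite_measure set T -> \bar R}).

(** Continuity from above: the differences decrease to the empty set and the measure is finite. *)
Lemma measure_bigcup_tail (F : (set T)^nat) (e : R) : 0 < e ->
  (forall i, measurable (F i)) ->
  exists N, (mu (\bigcup_i F i `\` \big[setU/set0]_(i < N) F i) <= e%:E)%E.
Proof.
move=> e0 mF; set G := \bigcup_i F i.
pose D N := G `\` \big[setU/set0]_(i < N) F i.
have mD N : measurable (D N).
  by apply: measurableD; [exact: bigcupT_measurable|exact: bigsetU_measurable].
have D0 : \bigcap_N D N = set0.
  apply/seteqP; split=> // x Dx; have [[i _ Fix] _] := Dx 0%N I.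
  have [_] := Dx i.+1 I; apply; rewrite -bigcup_mkord.
  by exists i => //=.
have /= := @nonincreasing_cvg_mu _ _ _ mu D _ mD.
rewrite D0 measure0 => Dcvg.
have {Dcvg}/fine_cvgP[Dfin /cvgr0Pnorm_le De] : mu (D N) @[N --> \oo] --> 0%E.
  apply: Dcvg => //; first by rewrite ltey_eq fin_num_measure.
  apply/nonincreasing_seqP => n; apply/subsetPset => x [Gx nx]; split=> // xn.
  by apply: nx; rewrite big_ord_recr; left.
have [N _ /(_ N (leqnn N)) NP] := filterI Dfin (De e e0).
exists N; move: NP => [fin /= le_e]; rewrite -[leLHS]fineK // lee_fin.
exact: le_trans (ler_norm _) le_e.
Qed.

End finite_measure_lemmas.

(** * Invariant measures of fragmented open sets *)

Section borel_measures.
Context (R : realType) (T : ptopologicalType) (phi : T -> T).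
Hypothesis phi_cont : continuous phi.
Implicit Type mu : probability (borel T) R.

Lemma open_borel (O : set (borel T)) : @open T O -> measurable O.
Proof. by move=> oO; exact: sub_sigma_algebra. Qed.

Lemma closed_borel (K : set (borel T)) : @closed T K -> measurable K.
Proof.
move=> /closed_openC oK; rewrite -[K]setCK; apply: measurableC.
exact: open_borel.
Qed.

Lemma borel_measurable_continuous (e : set (borel T)) :
  measurable e -> measurable (phi @^-1` e : set (borel T)).
Proof.
have mphi : @measurable_fun _ _ (borel T) (borel T) setT phi.
  apply: (@measurability _ _ (borel T) (borel T) setT phi (@open T)) => //.
  move=> _ [V oV <-]; rewrite setTI; apply: open_borel.
  by apply: open_comp => // z _; exact: phi_cont.
by move=> me; rewrite -[X in measurable X]setTI; exact: mphi.
Qed.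

Lemma measure_iter mu n (O : set (borel T)) : invariant_measure phi mu ->
  measurable O -> mu (iter n phi @^-1` O) = mu O.
Proof.
move=> inv; elim: n O => // n IHn O mO.
rewrite -(inv O mO) -(IHn (phi @^-1` O)) //.
exact: borel_measurable_continuous.
Qed.

Context (base : nat -> set T).
Hypotheses (obase : forall i, open (base i)).
Hypothesis (baseP :
  forall x O, open O -> O x -> exists2 i, base i x & base i `<=` O).
Context (U : set_system nat).
Hypothesis (UU : UltraFilter U).
Context (A : set T).
Hypothesis (oA : open A).
Hypothesis (fragA : forall E : set T, E !=set0 ->
  exists2 O, open O /\ O `&` E !=set0 &
    U [set n | forall x, O x -> E x -> ~ A (iter n phi x)]).

(* The largest open set on which the preimages of [A] are negligible along [U]
   is everything: fragmentation would enlarge it otherwise. *)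
Lemma fragmented_measure0 mu : invariant_measure phi mu -> mu A = 0%E.
Proof.
move=> inv.
pose An n : set (borel T) := iter n phi @^-1` A.
have mAn n : measurable (An n).
  apply: open_borel; apply: open_comp => // z _.
  exact: continuous_iter.
pose null (V : set (borel T)) := forall e : R, 0 < e ->
  U [set n | (mu (V `&` An n) <= e%:E)%E].
have nullU V W : measurable V -> measurable W -> null V -> null W -> null (V `|` W).
  move=> mV mW nV nW e e0; have e20 : 0 < e / 2 by rewrite divr_gt0.
  apply: filterS (filterI (nV _ e20) (nW _ e20)) => n [/= Vn Wn].
  rewrite setIUl; apply: le_trans (measureU2 _ _ _) _;
    [exact: measurableI|exact: measurableI|].
  by rewrite [e in leRHS]splitr EFinD leeD.
(* Indexing the null open sets by a countable base lets their union be handled by finite unions and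
   a small tail. *)
pose C i : set (borel T) := if `[< null (base i) >] then base i else set0.
have mC i : measurable (C i).
  by rewrite /C; case: ifP => // _; apply: open_borel.
have nullC i : null (C i).
  rewrite /C; case: asboolP => // _ e e0; apply: filterS (filterT) => n _ /=.
  by rewrite set0I measure0 lee_fin ltW.
pose F N := \big[setU/set0]_(i < N) C i.
have mF N : measurable (F N) by exact: bigsetU_measurable.
have nullF N : null (F N).
  elim: N => [|N IHN]; last by rewrite /F big_ord_recr; apply: nullU => //; exact: mF.
  move=> e e0; apply: filterS (filterT) => n _ /=.
  by rewrite /F big_ord0 set0I measure0 lee_fin ltW.
pose G := \bigcup_i C i.
have mG : measurable G by exact: bigcupT_measurable.
have nullG : null G.
  move=> e e0; have e20 : 0 < e / 2 by rewrite divr_gt0.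
  have [N GN] := measure_bigcup_tail mu e20 mC.
  apply: filterS (nullF N _ e20) => n /= Fn.
  have GE : G `&` An n `<=` (F N `&` An n) `|` (G `\` F N).
    move=> x [Gx Ax]; have [Fx|nFx] := pselect (F N x); first by left.
    by right.
  apply: le_trans (le_measure mu _ _ GE) _; rewrite ?inE.
  - exact: measurableI.
  - by apply: measurableU; [exact: measurableI|exact: measurableD].
  apply: le_trans (measureU2 _ _ _) _; [exact: measurableI|exact: measurableD|].
  by rewrite [e in leRHS]splitr EFinD leeD.
have GT : G = setT.
  apply/seteqP; split=> // x0 _; apply: contrapT => nGx0.
  (* For [U]-many [n], the part of [O] that [iter n phi] sends into [A] lies in [G]. Base sets
     inside [O] are therefore null, which puts [x] in [G]. *)
  have [|O [ oO [x [Ox nGx]]] OA] := fragA (E := ~` G); first by exists x0.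
  have [i ix iO] := baseP oO Ox.
  apply: nGx; exists i => //; rewrite /C; case: asboolP => // -[] e e0.
  apply: filterS (filterI OA (nullG e e0)) => n [/= nA]; apply: le_trans.
  apply: le_measure; rewrite ?inE.
  - by apply: measurableI => //; apply: open_borel.
  - exact: measurableI.
  - move=> z [iz Az]; split=> //; apply: contrapT => nGz.
    exact: nA z (iO _ iz) nGz Az.
apply/eqP; rewrite eq_le measure_ge0 andbT; apply/lee_addgt0Pr => e e0.
have [n /=] := filter_ex (nullG e e0).
by rewrite GT setTI add0e measure_iter //; exact: open_borel.
Qed.

End borel_measures.

(** * From finitely additive contents to Borel measures *)

Section content.
Context (R : realType) (T : ptopologicalType).
Hypotheses (hT : hausdorff_space T) (cptT : compact [set: T]).

(** Only finite additivity survives in an ultralimit of measures. *)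
Definition finitely_additive_probability (nu : set (borel T) -> R) :=
  [/\ nu set0 = 0, nu setT = 1, forall A, measurable A -> 0 <= nu A &
    forall A B, measurable A -> measurable B -> A `&` B = set0 ->
      nu (A `|` B) = nu A + nu B].

Context (nu : set (borel T) -> R).
Hypothesis nuP : finitely_additive_probability nu.

Lemma content_le (A B : set (borel T)) : measurable A -> measurable B ->
  A `<=` B -> nu A <= nu B.
Proof.
case: nuP => _ _ nu_ge0 nuD mA mB AB.
have mBA : measurable (B `\` A) by exact: measurableD.
rewrite -[B](setDUK AB) nuD ?setDIK // lerDl; exact: nu_ge0.
Qed.

Lemma content_subadd (A B : set (borel T)) : measurable A -> measurable B ->
  nu (A `|` B) <= nu A + nu B.
Proof.
case: nuP => _ _ nu_ge0 nuD mA mB.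
have mBA : measurable (B `\` A) by exact: measurableD.
have -> : A `|` B = A `|` (B `\` A) by rewrite setUDr setDv setD0.
rewrite nuD ?setDIK // lerD2l; exact: content_le.
Qed.

Local Open Scope ereal_scope.

(** With [content_outer] this is the regularisation of [nu]: from inside by closed, hence compact,
    sets, then from outside by open sets. Compactness is what yields countable additivity. *)
Definition inner_content (O : set T) : \bar R :=
  ereal_sup [set (nu K)%:E | K in [set K : set T | closed K /\ K `<=` O]].

Definition content_outer (A : set T) : \bar R :=
  ereal_inf [set inner_content O | O in [set O : set T | open O /\ A `<=` O]].

Let tau := inner_content.
Let mustar := content_outer.

Lemma content_le_inner (K O : set T) : closed K -> K `<=` O -> (nu K)%:E <= tau O.
Proof. by move=> cK KO; apply: ereal_sup_ubound; exists K. Qed.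

Lemma inner_content_le (O V : set T) : O `<=` V -> tau O <= tau V.
Proof.
move=> OV; apply/ereal_supP => _ [K [cK KO] <-].
by apply: content_le_inner => //; exact: subset_trans OV.
Qed.

Lemma inner_content_ge0 (O : set T) : 0 <= tau O.
Proof.
by have := content_le_inner closed0 (@sub0set _ O); case: nuP => ->.
Qed.

Lemma inner_content_le1 (O : set T) : tau O <= 1.
Proof.
case: nuP => _ nuT _ _.
apply/ereal_supP => _ [K [cK _] <-]; rewrite lee_fin -nuT.
by apply: content_le => //; exact: closed_borel.
Qed.

Lemma inner_content0 : tau set0 = 0.
Proof.
apply/eqP; rewrite eq_le inner_content_ge0 andbT.
apply/ereal_supP => _ [K [_ K0] <-]; have -> : K = set0 by apply/seteqP; split.
by case: nuP => ->.
Qed.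

(** Normality separates the disjoint closed sets [K] minus [O] and [K] minus [V]; removing each of
    the two neighbourhoods from [K] leaves closed pieces inside [O] and [V] that cover [K]. *)
Lemma inner_contentU (O V : set T) : open O -> open V ->
  tau (O `|` V) <= tau O + tau V.
Proof.
move=> oO oV; apply/ereal_supP => _ [K [cK KOV] <-].
have /(_ (K `\` O) (K `\` V)) := (@normal_openP R T).1 (compact_normal hT cptT).
have cKO : closed (K `\` O) by rewrite setDE; apply: closedI => //; exact: open_closedC.
have cKV : closed (K `\` V) by rewrite setDE; apply: closedI => //; exact: open_closedC.
have KOV0 : (K `\` O) `&` (K `\` V) = set0.
  by apply/seteqP; split=> // x [[Kx nOx] [_ nVx]]; case: (KOV _ Kx).
move=> /(_ cKO cKV KOV0)[W1 [W2 [oW1 oW2 KW1 KW2 W12]]].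
have cK1 : closed (K `\` W1) by rewrite setDE; apply: closedI => //; exact: open_closedC.
have cK2 : closed (K `\` W2) by rewrite setDE; apply: closedI => //; exact: open_closedC.
have K12 : K `<=` (K `\` W1) `|` (K `\` W2).
  move=> x Kx; have [W1x|nW1x] := pselect (W1 x); last by left.
  right; split=> // W2x; have : (W1 `&` W2) x by [].
  by rewrite W12.
apply: (@le_trans _ _ ((nu (K `\` W1))%:E + (nu (K `\` W2))%:E)).
  rewrite -EFinD lee_fin; apply: le_trans (content_subadd _ _).
  - apply: content_le => //; first exact: closed_borel.
    by apply: measurableU; exact: closed_borel.
  - exact: closed_borel.
  - exact: closed_borel.
apply: leeD; apply: content_le_inner => // x [Kx nWx]; apply: contrapT => nx.
  by apply: nWx; apply: KW1.
by apply: nWx; apply: KW2.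
Qed.

(** A closed set inside the union is compact, hence inside a finite subunion. *)
Lemma inner_content_bigcup (O : (set T)^nat) : (forall i, open (O i)) ->
  tau (\bigcup_i O i) <= \sum_(i <oo) tau (O i).
Proof.
move=> oO; apply/ereal_supP => _ [K [cK KO] <-].
have cptK : compact K by apply: subclosed_compact cptT _.
have [|N _ /(_ N (leqnn N)) KN] := (@compact_near_coveringP T K).1 cptK nat \oo
    (fun N => \big[setU/set0]_(i < N) O i).
  move=> x /KO[i _ Oix]; exists (O i, [set N | (i < N)%N]).
    by split=> /=; [exact: open_nbhs_nbhs|exact: nbhs_infty_gt].
  by move=> [y N] [/= Oiy iN]; rewrite -bigcup_mkord; exists i.
apply: (@le_trans _ _ (\sum_(0 <= i < N) tau (O i))); last first.
  by apply: nneseries_lim_ge => i _ _; exact: inner_content_ge0.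
apply: le_trans (content_le_inner cK KN) _; rewrite big_mkord.
elim: N {KN} => [|N IHN]; first by rewrite !big_ord0 inner_content0.
rewrite !big_ord_recr /=; apply: le_trans (inner_contentU _ (oO N)) _.
  by rewrite -bigcup_mkord; apply: bigcup_open => i _; exact: oO.
exact: leeD2r.
Qed.

Lemma content_outer_le (A O : set T) : open O -> A `<=` O -> mustar A <= tau O.
Proof. by move=> oO AO; apply: ereal_inf_lbound; exists O. Qed.

Lemma content_outer_open (O : set T) : open O -> mustar O = tau O.
Proof.
move=> oO; apply/eqP; rewrite eq_le content_outer_le //=.
by apply/ereal_infP => _ [V [_ OV] <-]; exact: inner_content_le.
Qed.

Lemma content_outer_ge0 (A : set T) : 0 <= mustar A.
Proof. by apply/ereal_infP => _ [ O _ <-]; exact: inner_content_ge0. Qed.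

Lemma content_outer_fin_num (A : set T) : mustar A \is a fin_num.
Proof.
rewrite ge0_fin_numE ?content_outer_ge0 //.
apply: le_lt_trans (ltry 1); apply: le_trans (inner_content_le1 setT).
by apply: content_outer_le => //; exact: openT.
Qed.

Lemma inner_content_fin_num (A : set T) : tau A \is a fin_num.
Proof.
rewrite ge0_fin_numE ?inner_content_ge0 //.
by apply: le_lt_trans (ltry 1); exact: inner_content_le1.
Qed.

Lemma content_outer0 : mustar set0 = 0.
Proof. by rewrite content_outer_open ?inner_content0 //; exact: open0. Qed.

Lemma content_outer_homo : {homo mustar : A B / A `<=` B >-> A <= B}.
Proof.
move=> A B AB; apply/ereal_infP => _ [ O [oO BO] <-].
by apply: content_outer_le => //; exact: subset_trans BO.
Qed.

Lemma content_outer_sigma_subadditive : sigma_subadditive mustar.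
Proof.
move=> F; apply/lee_addgt0Pr => e e0.
apply: le_trans (epsilon_trick xpredT (fun i => content_outer_ge0 (F i)) (ltW e0)).
have /choice[ O OP] : forall i, exists O : set T, [/\ open O, F i `<=` O &
    tau O <= mustar (F i) + (e / (2 ^ i.+1)%:R)%:E].
  move=> i; have ei : (0 < e / (2 ^ i.+1)%:R)%R.
    by rewrite divr_gt0 // ltr0n expn_gt0.
  have [_ [ O [oO FO] <-] tauO] :=
    lb_ereal_inf_adherent ei (content_outer_fin_num (F i)).
  by exists O; split=> //; exact: ltW.
apply: (@le_trans _ _ (\sum_(i <oo) tau (O i))).
  apply: le_trans (inner_content_bigcup _); last by move=> i; have [] := OP i.
  apply: content_outer_le; first by apply: bigcup_open => i _; have [] := OP i.
  by move=> x [i _ Fix]; exists i => //; have [_ + _] := OP i; exact.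
apply: lee_nneseries => [i _ _|i _]; first exact: inner_content_ge0.
by have [] := OP i.
Qed.

(** For open [W] around [X], take [K] closed in the intersection of [W] and [O], then [L] closed in
    [W] minus [K]. They are disjoint, so their contents add up to at most [tau W]. *)
Lemma open_content_caratheodory (O X : set T) : open O ->
  mustar (X `&` O) + mustar (X `&` ~` O) <= mustar X.
Proof.
move=> oO; apply/ereal_infP => _ [W [oW XW] <-].
apply: (@le_trans _ _ (tau (W `&` O) + mustar (X `&` ~` O))).
  apply: leeD2r; apply: content_outer_le; first exact: openI.
  exact: setSI.
rewrite -leeBrDr ?content_outer_fin_num //.
apply/ereal_supP => _ [K [cK KWO] <-].
rewrite leeBrDr ?content_outer_fin_num // addeC -leeBrDr //.
apply: (@le_trans _ _ (tau (W `&` ~` K))).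
  apply: content_outer_le; first by apply: openI => //; exact: closed_openC.
  by move=> x [Xx nOx]; split; [exact: XW|move=> /KWO[]].
apply/ereal_supP => _ [L [cL LWK] <-]; rewrite leeBrDr // -EFinD.
have LK0 : L `&` K = set0 by apply/seteqP; split=> // x [/LWK[_ nK] /nK].
have [_ _ _ nuD] := nuP.
rewrite -nuD //; try exact: closed_borel.
apply: content_le_inner; first exact: closedU.
by move=> x [/LWK[]|/KWO[]].
Qed.

(** The measure need not extend [nu]. The bound on closed [K] holds because every open set around
    [K] has inner content at least [nu K]. *)
Lemma content_measure : exists mu : probability (borel T) R,
  [/\ forall A, mu A = mustar A, forall O, open O -> mu O = tau O &
    forall K : set T, closed K -> (nu K)%:E <= mu K].
Proof.
pose om : {outer_measure set T -> \bar R} := HB.pack mustar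
  (isOuterMeasure.Build R T mustar content_outer0 content_outer_ge0
    content_outer_homo content_outer_sigma_subadditive).
have cara (A : set (borel T)) : measurable A -> om.-cara.-measurable A.
  apply: smallest_sub; first exact: sigma_algebra_measurable.
  move=> O oO; apply: le_caratheodory_measurable => X.
  exact: open_content_caratheodory.
have sadd : semi_sigma_additive (mustar : set (borel T) -> \bar R).
  move=> F mF tF mUF; apply: (@caratheodory_measure_sigma_additive R T om) => //.
    by move=> i; exact: cara.
  exact: cara.
have muT : mustar setT = 1.
  rewrite content_outer_open; last exact: openT.
  apply/eqP; rewrite eq_le inner_content_le1 /=; have [_ nuT _ _] := nuP.
  by rewrite -nuT; apply: content_le_inner => //; exact: closedT.
pose M := isMeasure.Build _ (borel T) R mustar content_outer0 content_outer_ge0 sadd.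
pose m : {measure set (borel T) -> \bar R} := HB.pack mustar M.
pose mu : probability (borel T) R := HB.pack (mustar : set (borel T) -> \bar R) M
  (Measure_isProbability.Build _ (borel T) R m muT).
exists mu; split=> // [ O oO|K cK]; first exact: content_outer_open.
by apply/ereal_infP => _ [ O [oO KO] <-]; exact: content_le_inner.
Qed.

End content.

(** * Invariant measures as limits *)

Section invariant_measures.
Context (R : realType) (T : ptopologicalType) (phi : T -> T).
Hypotheses (hT : hausdorff_space T) (cptT : compact [set: T]).
Hypothesis phi_cont : continuous phi.

Lemma measure_eq_open (mu1 mu2 : {measure set (borel T) -> \bar R}) :
  (mu1 setT < +oo)%E -> (forall O : set T, open O -> mu1 O = mu2 O) ->
  forall e : set (borel T), measurable e -> mu1 e = mu2 e.
Proof.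
move=> mu1oo mu12; apply: (@measure_unique _ R (borel T) (@open T) (fun=> setT)) => //.
- exact: openI.
- by move=> _; exact: openT.
- by apply/seteqP; split=> // x _; exists 0%N.
Qed.

(** It suffices to compare inner contents of an open set and its preimage: closed sets inside the
    preimage are pushed forward by [phi], closed sets inside the open set are pulled back. *)
Lemma content_invariant_measure (nu : set (borel T) -> R) :
  finitely_additive_probability nu ->
  (forall A : set (borel T), measurable A -> nu (phi @^-1` A) = nu A) ->
  exists2 mu : probability (borel T) R, invariant_measure phi mu &
    forall K : set T, closed K -> ((nu K)%:E <= mu K)%E.
Proof.
move=> nuP nuinv; have [mu [_ muO muK]] := content_measure hT cptT nuP.
exists mu => // e me.
have mphi : @measurable_fun _ _ (borel T) (borel T) setT phi.
  by move=> _ A mA; rewrite setTI; exact: borel_measurable_continuous.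
(* The two measures compared are the pushforward of [mu] by [phi] and [mu] itself. *)
apply: (@measure_eq_open
  (measure_function_pushforward__canonical__measure_function_Measure mu mphi)
  mu _ _ e me).
  by change (mu setT < +oo)%E; rewrite probability_setT ltry.
move=> O oO; have oO' : open (phi @^-1` O).
  by apply: open_comp => // z _; exact: phi_cont.
change (mu (phi @^-1` O) = mu O); rewrite !muO //; apply/eqP; rewrite eq_le.
apply/andP; split; apply/ereal_supP => _ [K [cK KO] <-].
  have cphiK : closed (phi @` K).
    apply: compact_closed => //; apply: continuous_compact.
      exact: continuous_subspaceT.
    exact: subclosed_compact cptT _.
  apply: le_trans (content_le_inner nu cphiK _); last first.
    by move=> _ [x /KO Ox <-].
  rewrite lee_fin -(nuinv (phi @` K)); last exact: closed_borel.
  apply: content_le => //.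
  - exact: closed_borel.
  - by apply: borel_measurable_continuous => //; exact: closed_borel.
  - by move=> x Kx; exists x.
rewrite -nuinv; last exact: closed_borel.
apply: content_le_inner; last by move=> x /KO.
by apply: preimage_closed => // z _; exact: phi_cont.
Qed.

Lemma ultrafilter_compact_cvg (X : topologicalType) (U : set_system nat)
    (K : set X) (u : nat -> X) :
  UltraFilter U -> compact K -> U [set n | K (u n)] ->
  exists p : X, u @ U --> p.
Proof.
move=> UU cptK UK; have [p [_ clp]] := cptK (u @ U) _ UK.
exists p => V Vp; have [//|UnV] := in_ultra_setVsetC (u @^-1` V) UU.
by have [x [nVx Vx]] := clp (~` V) V UnV Vp.
Qed.

(** The limit along a free ultrafilter is a finitely additive invariant content, whose
    regularisation can only gain mass on closed sets; lower bounds there survive. *)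
Lemma limit_invariant_measure (u : nat -> set (borel T) -> R) :
  (forall n, finitely_additive_probability (u n)) ->
  (forall A : set (borel T), measurable A ->
    (u n (phi @^-1` A) - u n A) @[n --> \oo] --> 0) ->
  exists2 mu : probability (borel T) R, invariant_measure phi mu &
    forall (K : set T) (a : R), closed K -> (\forall n \near \oo, a <= u n K) ->
      (a%:E <= mu K)%E.
Proof.
move=> uP uinv.
have [U [UU ooU]] := ultraFilterLemma (@eventually_filter).
pose nu (A : set (borel T)) := lim (u n A @[n --> U]).
have u01 n A : measurable A -> 0 <= u n A <= 1.
  move=> mA; have [_ u1 u_ge0 _] := uP n.
  by rewrite u_ge0 //= -u1; apply: content_le.
have cvgu A : measurable A -> cvg (u n A @[n --> U]).
  move=> mA; have U01 : U [set n | `[0, 1]%classic (u n A)].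
    by apply: filterS (filterT) => n _ /=; rewrite in_itv /=; exact: u01.
  have [p up] := ultrafilter_compact_cvg UU (@segment_compact R 0 1) U01.
  by apply/cvg_ex; exists p.
have ucvg A : measurable A -> u n A @[n --> U] --> nu A by move=> /cvgu.
have nuE (A : set (borel T)) l : u n A @[n --> U] --> l -> nu A = l.
  by move=> ul; apply/cvg_lim.
have nuP : finitely_additive_probability nu.
  split.
  - apply: nuE; rewrite (_ : (fun _ => _) = fun=> 0); first exact: cvg_cst.
    by apply/funext => n; have [-> _ _ _] := uP n.
  - apply: nuE; rewrite (_ : (fun _ => _) = fun=> 1); first exact: cvg_cst.
    by apply/funext => n; have [_ -> _ _] := uP n.
  - move=> A mA; apply: limr_ge; first exact: cvgu.
    by apply: filterS (filterT) => n _; have /andP[] := u01 n _ mA.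
  - move=> A B mA mB AB; apply: nuE.
    rewrite (_ : (fun _ => _) = fun n => u n A + u n B).
      by apply: cvgD; exact: ucvg.
    by apply/funext => n; have [_ _ _ ->] := uP n.
have nuinv (A : set (borel T)) : measurable A -> nu (phi @^-1` A) = nu A.
  move=> mA; have mpA := borel_measurable_continuous phi_cont mA.
  apply/eqP; rewrite -subr_eq0; apply/eqP.
  have h1 := cvgB (ucvg _ mpA) (ucvg _ mA).
  have h2 : (u n (phi @^-1` A) - u n A) @[n --> U] --> 0.
    by move=> V /(uinv _ mA) /ooU.
  by rewrite -(cvg_lim (@Rhausdorff R) (h1 _)) -(cvg_lim (@Rhausdorff R) h2).
have [mu inv muK] := content_invariant_measure nuP nuinv.
exists mu => // K a cK aK; apply: le_trans (muK _ cK); rewrite lee_fin.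
apply: limr_ge; first by apply: cvgu; exact: closed_borel.
exact: ooU.
Qed.

End invariant_measures.

(** * Conditioning *)

Section probability_lemmas.
Context d (T : measurableType d) (R : realType) (mu : probability T R).

Lemma fine_probability (A : set T) : measurable A -> (fine (mu A))%:E = mu A.
Proof. by move=> mA; rewrite fineK // fin_num_measure. Qed.

Lemma conditional_probability (e : set T) : measurable e ->
  0 < fine (mu e) -> exists nu : probability T R,
    forall A, measurable A -> fine (nu A) * fine (mu e) = fine (mu (A `&` e)).
Proof.
move=> me mue; exists (mnormalize (mrestr mu me) mu) => A mA.
have meT : mrestr mu me setT = (fine (mu e))%:E.
  by rewrite /mrestr setTI fine_probability.
(* [mnormalize] branches on the total mass being zero or infinite; naming that mass [x] lets its
   value decide the branch. *)
have key (x : \bar R) (f g : set T -> \bar R) : x = (fine (mu e))%:E ->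
    g A = mu (A `&` e) ->
    fine ((if (x == 0%E) || (x == +oo%E) then f
           else fun B => (g B * (fine x)^-1%:E)%E) A) * fine (mu e) =
    fine (mu (A `&` e)).
  move=> -> gA; rewrite !eqe gt_eqF //= gA -fine_probability; last exact: measurableI.
  by rewrite -EFinM /= divfK // gt_eqF.
by apply: key => //; exact: meT.
Qed.

End probability_lemmas.

(** * Ergodic measures on a closed invariant set *)

Section ergodic_measures.
Context (R : realType) (T : ptopologicalType) (phi : T -> T).
Hypotheses (hT : hausdorff_space T) (cptT : compact [set: T]).
Hypothesis phi_cont : continuous phi.
Implicit Type mu : probability (borel T) R.

Lemma fine_probability_finitely_additive mu :
  finitely_additive_probability (fun A => fine (mu A)).
Proof.
split=> [||A mA|A B mA mB AB].
- by rewrite measure0.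
- by rewrite probability_setT.
- by rewrite fine_ge0.
- by rewrite measureU // fineD // fin_num_measure.
Qed.

(** Krylov-Bogolyubov: a limit of averages of Dirac masses along an orbit in [m]. *)
Lemma exists_invariant_measure (m : set T) : closed_forward_invariant phi m ->
  exists2 mu : probability (borel T) R, invariant_measure phi mu & (1 <= mu m)%E.
Proof.
move=> [[x mx] cm phim].
pose u n (A : set (borel T)) : R :=
  n.+1%:R^-1 * \sum_(i < n.+1) \1_A (iter i phi x).
have n1 n : n.+1%:R^-1 * \sum_(i < n.+1) 1 = 1 :> R.
  by rewrite sumr_const card_ord mulVf.
have in1 (E : set T) y : E y -> \1_E y = 1 :> R by move=> Ey; rewrite indicE mem_set.
have in0 (E : set T) y : ~ E y -> \1_E y = 0 :> R by move=> Ey; rewrite indicE memNset.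
have uP n : finitely_additive_probability (u n).
  split=> [||A mA|A B mA mB AB].
  - by rewrite /u big1 ?mulr0 // => i _; rewrite indic0.
  - by rewrite -[RHS](n1 n) /u; congr (_ * _); apply: eq_bigr => i _; rewrite indicT.
  - by rewrite mulr_ge0 // sumr_ge0.
  - rewrite -mulrDr -big_split /=; congr (_ * _); apply: eq_bigr => i _.
    have [Ax|Ax] := pselect (A (iter i phi x));
      have [Bx|Bx] := pselect (B (iter i phi x)).
    + by suff : set0 (iter i phi x) by []; rewrite -AB.
    + by rewrite (in1 (A `|` B)) ?(in1 A) ?(in0 B) ?addr0 //; left.
    + by rewrite (in1 (A `|` B)) ?(in0 A) ?(in1 B) ?add0r //; right.
    + by rewrite (in0 (A `|` B)) ?(in0 A) ?(in0 B) ?addr0 //; case.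
have uinv (A : set (borel T)) : measurable A ->
    (u n (phi @^-1` A) - u n A) @[n --> \oo] --> 0.
  (* The sums telescope to two boundary terms, so the difference is at most the inverse of [n.+1] in
     absolute value. *)
  move=> _; have uE n : u n (phi @^-1` A) - u n A =
      n.+1%:R^-1 * (\1_A (iter n.+1 phi x) - \1_A x).
    rewrite -mulrBr -sumrB; congr (_ * _).
    rewrite -(big_mkord xpredT (fun i => \1_(phi @^-1` A) (iter i phi x)
      - \1_A (iter i phi x) : R)).
    exact: (@telescope_sumr R 0 n.+1 (fun i => \1_A (iter i phi x)) (leq0n _)).
  apply: (@squeeze_cvgr _ _ _ _ (fun n => - harmonic n) harmonic).
  - apply: filterS (filterT) => n _; rewrite uE /harmonic.
    have n0 : 0 <= n.+1%:R^-1 :> R by [].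
    have ind01 y : 0 <= (\1_A y : R) <= 1.
      by rewrite indicE; case: (_ \in _); rewrite ?lexx ?ler01.
    have /andP[? ?] := ind01 (iter n.+1 phi x); have /andP[? ?] := ind01 x.
    rewrite -ler_norml normrM ger0_norm // ler_piMr // ler_norml.
    by apply/andP; split; lra.
  - by rewrite -oppr0; apply: cvgN; exact: cvg_harmonic.
  - exact: cvg_harmonic.
have [mu inv muK] := limit_invariant_measure hT cptT phi_cont uP uinv.
exists mu => //; apply: muK => //; apply: filterS (filterT) => n _.
rewrite -(n1 n) /u ler_pM2l // ler_sum // => i _; rewrite indicE mem_set //.
by elim: (nat_of_ord i) => //= k IHk; apply: phim; exists (iter k phi x).
Qed.

Context (base : nat -> set T).
Hypotheses (obase : forall i, open (base i)).
Hypothesis (baseP :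
  forall x O, open O -> O x -> exists2 i, base i x & base i `<=` O).

Let union (s : seq nat) : set T := \big[setU/set0]_(i <- s) base i.

Let union_open s : open (union s).
Proof.
elim: s => [|i s IHs]; first by rewrite /union big_nil; exact: open0.
by rewrite /union big_cons; apply: openU.
Qed.

(** An open set is exhausted, up to small measure, by finite unions of the base sets it contains. *)
Lemma probability_eq_base mu1 mu2 :
  (forall s, mu1 (~` union s) = mu2 (~` union s)) ->
  forall e : set (borel T), measurable e -> mu1 e = mu2 e.
Proof.
move=> mu12; apply: measure_eq_open.
  by have := ltry (1 : R); rewrite -(probability_setT mu1).
have munion s : measurable (union s : set (borel T)) by exact: open_borel.
have {}mu12 s : mu1 (union s) = mu2 (union s).
  have uE (nu : probability (borel T) R) : nu (union s) = (1 - nu (~` union s))%E.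
    by rewrite -[in LHS](setCK (union s)) probability_setC //; exact: measurableC.
  by rewrite !uE mu12.
suff le12 (nu1 nu2 : probability (borel T) R) (O : set T) :
    (forall s, nu1 (union s) = nu2 (union s)) -> open O ->
    (nu1 O <= nu2 O)%E.
  by move=> O oO; apply/eqP; rewrite eq_le !le12 // => s; apply: esym.
move=> {}mu12 oO; apply/lee_addgt0Pr => e e0.
pose C i := if `[< base i `<=` O >] then base i else set0.
have CO : \bigcup_i C i = O.
  apply/seteqP; split=> [x [i _]|x Ox].
    by rewrite /C; case: asboolP => // + ?; exact.
  have [i ix iO] := baseP oO Ox; exists i => //.
  by rewrite /C; case: asboolP.
have FE N : \big[setU/set0]_(i < N) C i =
    union [seq i <- iota 0 N | `[< base i `<=` O >]].
  by rewrite /union big_filter -(big_mkord xpredT C) /index_iota subn0 [RHS]big_mkcond.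
have mC i : measurable (C i : set (borel T)).
  by rewrite /C; case: ifP => // _; exact: open_borel.
have [N] := measure_bigcup_tail nu1 e0 mC; rewrite CO FE; set s := [seq _ <- _ | _].
move=> tail; have sO : union s `<=` O.
  by rewrite /s -FE -bigcup_mkord => x [i _ Cx]; rewrite -CO; exists i.
have mO : measurable (O : set (borel T)) by exact: open_borel.
rewrite -{1}(setDUK sO); apply: le_trans (measureU2 _ _ _) _ => //.
  exact: measurableD.
apply: leeD => //; have : (nu1 (union s) <= nu2 O)%E; last by [].
by rewrite mu12; apply: le_measure; rewrite ?inE.
Qed.

Context (m : set T).
Hypothesis m_inv : closed_forward_invariant phi m.

(** Lists of base indices are enumerated by their codes, shifted by one to put [m] first. A number
    coding no list gives the empty list, hence the whole space. *)
Let K j : set T := if j is i.+1 then ~` union (odflt [::] (unpickle i)) else m.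

Let closedK j : closed (K j).
Proof. by case: j => [|i]; [case: m_inv|exact: open_closedC]. Qed.

Let measurableK j : measurable (K j : set (borel T)).
Proof. exact: closed_borel. Qed.

(* Faces of the simplex of invariant measures, decreasing to a point. *)
Fixpoint maximizers j : set (probability (borel T) R) :=
  if j is i.+1 then [set mu | maximizers i mu /\
    forall nu, maximizers i nu -> fine (nu (K i)) <= fine (mu (K i))]
  else [set mu | invariant_measure phi mu].

Lemma maximizers_le i j mu : (i <= j)%N -> maximizers j mu -> maximizers i mu.
Proof. by move=> /subnK <-; elim: (j - i)%N => // k IHk [/IHk]. Qed.

(** Maximality passes to the limit: eventually [mu_ n] gives [K i] at least the mass that any
    competitor gives it, and this lower bound is kept since [K i] is closed. The [j] of the first
    clause is bound anew. *)
Lemma maximizers_limit (mu_ : nat -> probability (borel T) R) j :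
  (forall n, invariant_measure phi (mu_ n)) -> exists mu,
  (forall j, (\forall n \near \oo, maximizers j (mu_ n)) -> maximizers j mu) /\
  (forall a, (\forall n \near \oo, a <= fine (mu_ n (K j))) -> a <= fine (mu (K j))).
Proof.
move=> inv_.
have [|mu inv muK] := @limit_invariant_measure R T phi hT cptT phi_cont
  (fun n A => fine (mu_ n A)) (fun n => fine_probability_finitely_additive (mu_ n)).
  move=> A mA; rewrite (_ : (fun _ => _) = fun=> 0); first exact: cvg_cst.
  by apply/funext => n; rewrite inv_ // subrr.
have {}muK i a : (\forall n \near \oo, a <= fine (mu_ n (K i))) -> a <= fine (mu (K i)).
  by move=> /muK; rewrite -lee_fin fine_probability //; apply.
exists mu; split; last exact: muK.
elim=> // i IHi max_; split.
  by apply: IHi; apply: filterS max_ => n [].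
by move=> nu nui; apply: muK; apply: filterS max_ => n [_]; exact.
Qed.

(** A limit of measures in the face that approach the supremum attains it. *)
Lemma maximizers_neq0 j : maximizers j !=set0.
Proof.
elim: j => [|j [mu0 mu0P]].
  by have [mu inv _] := exists_invariant_measure m_inv; exists mu.
pose S := [set fine (mu (K j)) | mu in maximizers j].
have supS : has_sup S.
  split; first by exists (fine (mu0 (K j))), mu0.
  by exists 1 => _ [mu _ <-]; rewrite -lee_fin fine_probability // probability_le1.
have /choice[mu_ mu_P] : forall n, exists mu, maximizers j mu /\
    sup S - n.+1%:R^-1 < fine (mu (K j)).
  move=> n; have n0 : 0 < n.+1%:R^-1 :> R by rewrite invr_gt0.
  by have [_ [mu muj <-] ?] := sup_adherent n0 supS; exists mu.
have [|mu [muM muK]] := @maximizers_limit mu_ j.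
  by move=> n; have [/(maximizers_le (leq0n j))] := mu_P n.
exists mu; split; first by apply: muM; apply: filterS (filterT) => n _; case: (mu_P n).
move=> nu nuj; apply: (@le_trans _ _ (sup S)).
  by apply: ub_le_sup; [case: supS|exists nu].
apply/ler_addgt0Pl => e e0; rewrite -lerBlDl; apply: muK.
near=> n; have [_ /ltW] := mu_P n; apply: le_trans; rewrite lerB //.
by apply: ltW; near: n; exact: near_infty_natSinv_lt (PosNum e0).
Unshelve. all: by end_near. Qed.

(** A limit of measures chosen in successive faces lies in every face, because the faces
    decrease. *)
Lemma exists_maximizer : exists mu, forall j, maximizers j mu.
Proof.
have /choice[mu_ mu_P] := maximizers_neq0.
have [|mu [muM _]] := @maximizers_limit mu_ 0%N.
  by move=> n; exact: maximizers_le (leq0n n) (mu_P n).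
exists mu => j; apply: muM; exists j => // n jn; exact: maximizers_le (mu_P n).
Qed.

Lemma conditional_invariant (mu nu : probability (borel T) R) (e : set (borel T)) :
  measurable e -> phi @^-1` e = e -> invariant_measure phi mu ->
  0 < fine (mu e) ->
  (forall A : set (borel T), measurable A ->
    fine (nu A) * fine (mu e) = fine (mu (A `&` e))) ->
  invariant_measure phi nu.
Proof.
move=> me phie inv mue nuE A mA.
have mpA := borel_measurable_continuous phi_cont mA.
rewrite -(fine_probability nu mpA) -(fine_probability nu mA); congr EFin.
apply: (mulIf (lt0r_neq0 mue)); rewrite !nuE // -[in LHS]phie -preimage_setI inv //.
exact: measurableI.
Qed.

(* Conditioning on an invariant set of intermediate measure would write [mu] as
   a proper convex combination of two invariant measures; both lie in all the
   faces, so both equal [mu]. *)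
Lemma maximizer_ergodic mu : (forall j, maximizers j mu) -> ergodic_measure phi mu.
Proof.
move=> muM; have inv := muM 0%N; split=> // e me phie.
have mCe : measurable (~` e) by exact: measurableC.
have [->|mue0] := eqVneq (mu e) 0%E; [by left|right].
have mue : 0 < fine (mu e).
  by rewrite fine_gt0 // lt0e mue0 measure_ge0 ltey_eq fin_num_measure.
apply/eqP; apply: contraT => mue1.
have muCe : 0 < fine (mu (~` e)).
  rewrite probability_setC // -fine_probability // -EFinB /= subr_gt0.
  rewrite lt_neqAle -lee_fin fine_probability // probability_le1 // andbT.
  by apply: contra mue1 => /eqP mue1; rewrite -fine_probability // mue1.
have [nu1 nu1E] := conditional_probability me mue.
have [nu2 nu2E] := conditional_probability mCe muCe.
have convex (A : set (borel T)) : measurable A ->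
    fine (mu A) = fine (nu1 A) * fine (mu e) + fine (nu2 A) * (1 - fine (mu e)).
  move=> mA; have <- : fine (mu (~` e)) = 1 - fine (mu e).
    by rewrite probability_setC // fineB // fin_num_measure.
  rewrite nu1E // nu2E // -fineD ?fin_num_measure //; [|exact: measurableI..].
  rewrite -measureU; [|exact: measurableI..|].
    by rewrite -setIUr setUCr setIT.
  by apply/seteqP; split=> // x [[_ ?] [_]].
have nuK j : maximizers j nu1 -> maximizers j nu2 ->
    fine (nu1 (K j)) = fine (mu (K j)) /\ fine (nu2 (K j)) = fine (mu (K j)).
  have [_ maxj] := muM j.+1; move=> /maxj le1 /maxj le2.
  have muCe1 : 0 < 1 - fine (mu e).
    by move: muCe; rewrite probability_setC // fineB // fin_num_measure.
  (* On [K j] both conditional measures are at most [mu], which is their average with positive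
     weights; so all three agree. *)
  have := convex _ (measurableK j); split; nra.
have nuM j : maximizers j nu1 /\ maximizers j nu2.
  elim: j => [|j [M1 M2]].
    split; first exact: conditional_invariant nu1E.
    by apply: conditional_invariant nu2E => //; rewrite -preimage_setC phie.
  have [nu1K nu2K] := nuK j M1 M2; have [_ maxj] := muM j.+1.
  by split; split=> // nu /maxj; rewrite ?nu1K ?nu2K.
have nu1e : nu1 e = mu e.
  apply: probability_eq_base me => s.
  have [M1 M2] := nuM (pickle s).+1; have [+ _] := nuK (pickle s).+1 M1 M2.
  have -> : K (pickle s).+1 = ~` union s by rewrite /K pickleK.
  move=> nu1s.
  have ms := measurableC (open_borel (union_open s)).
  by rewrite -fine_probability // nu1s fine_probability.
(* Since [nu1] agrees with [mu] on [e], the mass of [e] equals its own square, and it is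
   positive. *)
have := nu1E e me; rewrite setIid nu1e => mu2.
case/negP: mue1; apply/eqP; rewrite -fine_probability //; congr EFin.
by apply: (mulIf (lt0r_neq0 mue)); rewrite mu2 mul1r.
Qed.

(** The first maximisation concerns [m], and some invariant measure already gives it full mass. *)
Lemma exists_ergodic_measure : exists2 mu : probability (borel T) R,
  ergodic_measure phi mu & mu m = 1%E.
Proof.
have [mu muM] := exists_maximizer; exists mu; first exact: maximizer_ergodic.
have [nu inv nu1] := exists_invariant_measure m_inv.
have [_ /(_ nu inv)] := muM 1%N; rewrite /K -lee_fin !fine_probability //;
  try exact: (measurableK 0%N).
move=> /(le_trans nu1) mu1; apply/eqP; rewrite eq_le mu1 andbT.
by apply: probability_le1; exact: (measurableK 0%N).
Qed.

(** The support is itself a closed invariant subset of [m], so minimality forces equality. *)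
Lemma ergodic_measure_support mu : minimal_set phi m ->
  invariant_measure phi mu -> mu m = 1%E -> m `<=` measure_support mu.
Proof.
move=> [_ minm] inv mu1.
have sm : measure_support mu `<=` m.
  move=> w sw; apply: contrapT => nmw.
  have oCm : open (~` m) by apply: closed_openC; case: m_inv.
  have := sw _ oCm nmw; rewrite probability_setC ?mu1 ?subee ?ltxx //.
  exact: (measurableK 0%N).
suff s_inv : closed_forward_invariant phi (measure_support mu).
  by apply: contrapT => nms; exact: minm s_inv (conj sm nms).
split.
- apply: contrapT => s0.
  (* If the support were empty, null base sets would cover the space. *)
  pose C i := if mu (base i) == 0%E then base i else set0.
  have mC i : measurable (C i : set (borel T)).
    by rewrite /C; case: ifP => // _; exact: open_borel.
  have CT : \bigcup_i C i = setT.
    apply/seteqP; split=> // x _; apply: contrapT => nCx; apply: s0; exists x.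
    move=> V oV /(baseP oV)[i ix iV]; apply: (@lt_le_trans _ _ (mu (base i))).
      rewrite lt0e measure_ge0 andbT; apply/negP => i0.
      by apply: nCx; exists i => //; rewrite /C i0.
    by apply: le_measure; rewrite ?inE //; exact: open_borel.
  have : mu.-negligible (\bigcup_i C i).
    apply: negligible_bigcup => i; apply/negligibleP => //.
    by rewrite /C; case: eqP => // _; rewrite measure0.
  rewrite CT => /negligibleP => /(_ measurableT) muT0.
  by have /eqP := probability_setT mu; rewrite [mu _]muT0 eq_sym onee_eq0.
- move=> w clw V oV Vw; have [z [sz Vz]] := clw V (open_nbhs_nbhs (conj oV Vw)).
  exact: sz.
- move=> _ [w sw <-] V oV Vw; rewrite -inv; last exact: open_borel.
  by apply: sw => //; apply: open_comp => // z _; exact: phi_cont.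
Qed.

End ergodic_measures.

(** * Supports of invariant measures and the two inclusions *)

(** Around a point [w] outside the closure, a Urysohn function equal to 1 at [w] and vanishing on a
    neighbourhood [B] of the minimal sets defines an open [A] containing [w]; fragmentation makes
    [A] null, so [w] is not in the support. *)
Lemma ergodic_support_minimal (R : realType) (T : ptopologicalType)
    (phi : T -> T) (mu : probability (borel T) R) :
  metrizable R T -> compact [set: T] -> continuous phi -> tame R phi ->
  invariant_measure phi mu ->
  measure_support mu `<=` closure (minimal_union phi).
Proof.
move=> mT cptT cphi tphi inv w sw; apply: contrapT => nMw.
have hT := metrizable_hausdorff mT; have nT := compact_normal hT cptT.
have [base obase baseP] := metrizable_countable_base mT cptT.
have cw : closed [set w] by apply: accessible_closed_set1; exact: hausdorff_accessible.
have cM := @closed_closure _ (minimal_union phi).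
have [|V [B [oV oB wV MB VB]]] := (@normal_openP R T).1 nT _ _ cw cM.
  by apply/seteqP; split=> // x [-> /nMw].
have [|f [cf f01 fCV fw]] := (@uniform_separatorP T R (~` V) [set w]).1
    ((@normal_separatorP R T).1 nT _ _ (open_closedC oV) cw _).
  by apply/seteqP; split=> // x [nVx xw]; apply: nVx; exact: wV.
pose A := f @^-1` [set r | 2^-1 < r].
have oA : open A by apply: open_comp => [z _|]; [exact: cf|exact: open_gt].
have Aw : A w.
  by rewrite /A /= (fw (f w)); [rewrite invf_lt1 // ltr1n|exists w].
have [U [UU Ufree UB]] := ultrafilter_to_minimal_union hT cptT cphi.
have frag (E : set T) : E !=set0 -> exists2 O, open O /\ O `&` E !=set0 &
    U [set n | forall x, O x -> E x -> ~ A (iter n phi x)].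
  apply: (@tame_fragmented R T phi f 2^-1 A B) => //.
  - by move=> x; have := f01 (f x) (ex_intro2 _ _ x I erefl); rewrite /= in_itv.
  - by move=> x /ltW.
  - move=> x Bx; apply: fCV; exists x => // Vx.
    by have : (V `&` B) x by []; rewrite VB.
  - by move=> x; apply: UB => // z Mz; apply: MB; exact: subset_closure.
have := sw A oA Aw.
by rewrite (fragmented_measure0 cphi obase baseP UU oA frag inv) ltxx.
Qed.

Unset Implicit Arguments.

Theorem proposition3p4 (R : realType) (T : ptopologicalType) (phi : T -> T)
    (T_metrizable : metrizable R T) (T_compact : compact [set: T])
    (phi_continuous : continuous phi) (phi_tame : tame R phi) :
  closure (minimal_union phi) = attraction_center R phi.
Proof.
have hT := metrizable_hausdorff T_metrizable.
have [base obase baseP] := metrizable_countable_base T_metrizable T_compact.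
apply/seteqP; split.
  apply: closureS => x [m mmin mx].
  have m_inv := mmin.1.
  have [mu mu_erg mum] :=
    exists_ergodic_measure R hT T_compact phi_continuous obase baseP m_inv.
  exists mu => //.
  exact: (ergodic_measure_support phi_continuous obase baseP m_inv mmin
    mu_erg.1 mum mx).
(* The right-hand side becomes the closure of a closed set, so it is enough to place each support in
   that set. *)
rewrite [X in _ `<=` X](iffLR (closure_id _) (@closed_closure _ (minimal_union phi))).
apply: closureS => x [mu [inv _]].
exact: (ergodic_support_minimal T_metrizable T_compact phi_continuous phi_tame inv).
Qed.
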